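(* For any moving sofa $S$ with rotation angle $\omega\in(0,\pi/2]$ in standard position, $\mathcal{I}(S)$ is a moving sofa with the same rotation angle $\omega$ in standard position containing $S$.
   Context: $u_t=(\cos t,\sin t)$, $v_t=(-\sin t,\cos t)$; for nonempty compact $S\subset\mathbb{R}^2$, $h_S(t)=\sup\{s\cdot u_t:s\in S\}$. The hallway is $L=H_L\cup V_L$, $H_L=(-\infty,1]\times[0,1]$, $V_L=[0,1]\times(-\infty,1]$. A moving sofa is a nonempty connected closed set $S$ for which there is a continuous curve $\Phi:[0,1]\to\mathrm{SE}(2)$ (a movement) with $\Phi_0$ a translation, $\Phi_0(S)\subseteq H_L$, $\Phi_s(S)\subseteq L$ for all $s$, $\Phi_1(S)\subseteq V_L$. The rotation angle is the total clockwise angle by which the movement rotates $S$ (continuous lift of the clockwise angle of $\Phi_s$, starting at $0$ when $s=0$, evaluated at $s=1$). A moving sofa $S$ with rotation angle $\omega\in(0,\pi/2]$ is in standard position if $h_S(\omega)=h_S(\pi/2)=1$. For nonempty compact $S$ and angle $t$, the supporting hallway is $L_S(t)=R_t(L)+(h_S(t)-1)u_t+(h_S(t+\pi/2)-1)v_t$, where $R_t$ is the counterclockwise rotation about the origin by $t$. With $P_\omega=\{p\in\mathbb{R}^2: 0\le p\cdot u_{\pi/2}\le1,\ 0\le p\cdot u_\omega\le 1\}$, define $\mathcal{I}(S)=P_\omega\cap\bigcap_{t\in[0,\omega]}L_S(t)$. *)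

(* Defs.v *)
From HB Require Import structures.
From mathcomp Require Import all_boot all_order all_algebra.
From mathcomp Require Import all_classical all_reals all_analysis.
Set Implicit Arguments.
Unset Strict Implicit.
Unset Printing Implicit Defensive.
Import Order.TTheory GRing.Theory Num.Theory.
Import numFieldNormedType.Exports.
Local Open Scope classical_set_scope.
Local Open Scope ring_scope.

(* The plane is 'cV[R]_2: the point (x, y) has x = p 0 0 and y = p 1 0. *)

Definition dot (R : realType) (p q : 'cV[R]_2) : R := \sum_i p i 0 * q i 0.

Definition u_ (R : realType) (t : R) : 'cV[R]_2 :=
  \col_i (if i == 0 then cos t else sin t).

Definition v_ (R : realType) (t : R) : 'cV[R]_2 :=
  \col_i (if i == 0 then - sin t else cos t).

(* The columns are u_t and v_t, so this is the counterclockwise rotation. *)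
Definition rotmx (R : realType) (t : R) : 'M[R]_2 :=
  \matrix_(i, j) (if j == 0 then u_ t i 0 else v_ t i 0).

(* Only meaningful for S nonempty and bounded. A moving sofa whose rotation
   angle lies in (0, pi / 2] is bounded, being enclosed by two transverse
   strips, so no compactness needs to be assumed below. *)
Definition hsupp (R : realType) (S : set 'cV[R]_2) (t : R) : R :=
  sup [set dot s (u_ t) | s in S].

Definition hall_H (R : realType) : set 'cV[R]_2 :=
  [set p | p 0 0 <= 1 /\ 0 <= p 1 0 <= 1].
Arguments hall_H R : clear implicits.

Definition hall_V (R : realType) : set 'cV[R]_2 :=
  [set p | 0 <= p 0 0 <= 1 /\ p 1 0 <= 1].
Arguments hall_V R : clear implicits.

Definition hallway (R : realType) : set 'cV[R]_2 := hall_H R `|` hall_V R.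
Arguments hallway R : clear implicits.

Definition SO2 (R : realType) : set 'M[R]_2 :=
  [set A | A^T *m A = 1%:M /\ \det A = 1].
Arguments SO2 R : clear implicits.

(* The pair (A, b) stands for the map x |-> A x + b; SE2 carries the subspace
   topology of 'M[R]_2 * 'cV[R]_2. *)
Definition SE2 (R : realType) : set ('M[R]_2 * 'cV[R]_2) :=
  [set g | SO2 R g.1].
Arguments SE2 R : clear implicits.

Definition rigid_act (R : realType) (g : 'M[R]_2 * 'cV[R]_2) (x : 'cV[R]_2) :
  'cV[R]_2 := g.1 *m x + g.2.

(* Only the values of Phi on [0, 1] matter. *)
Definition movement (R : realType) (S : set 'cV[R]_2)
    (Phi : R -> 'M[R]_2 * 'cV[R]_2) : Prop :=
  [/\ {within `[0, 1], continuous Phi},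
      forall s, 0 <= s <= 1 -> SE2 R (Phi s),
      (Phi 0).1 = 1%:M,
      rigid_act (Phi 0) @` S `<=` hall_H R /\ rigid_act (Phi 1) @` S `<=` hall_V R &
      forall s, 0 <= s <= 1 -> rigid_act (Phi s) @` S `<=` hallway R].

(* theta is the continuous lift of the clockwise angle, hence the sign. *)
Definition rotation_angle (R : realType) (Phi : R -> 'M[R]_2 * 'cV[R]_2)
    (w : R) : Prop :=
  exists theta : R -> R,
    [/\ {within `[0, 1], continuous theta},
        theta 0 = 0,
        forall s, 0 <= s <= 1 -> (Phi s).1 = rotmx (- theta s) &
        theta 1 = w].

(* A shape may have several movements, with different rotation angles: the
   angle is a relation, witnessed by some movement. *)
Definition moving_sofa (R : realType) (w : R) (S : set 'cV[R]_2) : Prop :=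
  [/\ S !=set0, connected S, closed S &
      exists Phi, movement S Phi /\ rotation_angle Phi w].

Definition standard_position (R : realType) (w : R) (S : set 'cV[R]_2) : Prop :=
  hsupp S w = 1 /\ hsupp S (pi / 2) = 1.

Definition supp_hallway (R : realType) (S : set 'cV[R]_2) (t : R) :
  set 'cV[R]_2 :=
  [set rotmx t *m x + (hsupp S t - 1) *: u_ t + (hsupp S (t + pi / 2) - 1) *: v_ t
  | x in hallway R].

Definition parallelogram (R : realType) (w : R) : set 'cV[R]_2 :=
  [set p | 0 <= dot p (u_ (pi / 2)) <= 1 /\ 0 <= dot p (u_ w) <= 1].

Definition calI (R : realType) (w : R) (S : set 'cV[R]_2) : set 'cV[R]_2 :=
  parallelogram w `&` \bigcap_(t in `[0, w]) supp_hallway S t.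

(* Main.v *)
Require Import Defs.
From mathcomp Require Import all_boot all_order all_algebra.
From mathcomp Require Import all_classical all_reals all_analysis.
From mathcomp Require Import ring lra.
Import Order.TTheory GRing.Theory Num.Theory.
Import numFieldNormedType.Exports.
Local Open Scope classical_set_scope.
Local Open Scope ring_scope.

(** Write h for the support function of S and I for the intersection calI w S.

    S lies in I. The lift theta of the rotation angle is continuous from 0 to w,
    so at some moment the movement has rotated S by any given t in [0, w]. At
    that moment S sits in a rotated and translated copy of the hallway; sliding
    this copy back until both its outer walls touch S turns it into the
    supporting hallway at t, and moves its inner quadrant away from S. The first
    and last moments give the two strips of the parallelogram, pinned down by
    h(w) = h(pi/2) = 1. This is hallway_subset_supp and sofa_subset_calI. The
    same two moments bound S (sofa_compact), so h is attained and continuous.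

    I moves. At angle t, move the supporting hallway rigidly onto the hallway.
    Every supporting hallway with t in [0, w] contains I, so this keeps I in the
    hallway throughout, and it is continuous because h is; at t = 0 and t = w
    the two strips put I in the horizontal and in the vertical side. This is
    calI_moves.

    I is connected; this is the one delicate point. The supporting hallway at t
    is a convex quadrant minus an open quadrant pointing along - u_t, - v_t. A
    point outside the removed quadrant stays outside when it is translated by
    d, as soon as d . u_t and d . v_t are nonnegative. The directions of the
    cone spanned by u_w and u_(pi/2) have this property for all t in [0, w] at
    once (up_dirP), so two points of I which differ by such a direction are
    joined by a segment in I (segment_up). Every p in I can be so joined to a
    point of S (calI_reaches): S is connected and reaches the supporting lines
    at angles 0 and w + pi/2, which bound I, so if S misses the lines through p
    with directions u_(pi/2) and u_w, then it lies on the far side of both,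
    that is, inside the cone at p. Thus I is a union of segments attached to
    the connected set S. *)

(** * Coordinates in the plane *)

Lemma dotE {R : realType} (p q : 'cV[R]_2) :
  dot p q = p 0 0 * q 0 0 + p 1 0 * q 1 0.
Proof.
rewrite /dot big_ord_recl big_ord1.
by rewrite (_ : lift ord0 ord0 = 1) //; apply/val_inj.
Qed.

Lemma dot_u {R : realType} (p : 'cV[R]_2) t :
  dot p (u_ t) = p 0 0 * cos t + p 1 0 * sin t.
Proof. by rewrite dotE !mxE. Qed.

Lemma dot_v {R : realType} (p : 'cV[R]_2) t :
  dot p (v_ t) = p 1 0 * cos t - p 0 0 * sin t.
Proof. by rewrite dotE !mxE /=; ring. Qed.

Lemma dot_u0 {R : realType} (p : 'cV[R]_2) : dot p (u_ 0) = p 0 0.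
Proof. by rewrite dot_u cos0 sin0 mulr1 mulr0 addr0. Qed.

Lemma dot_u_pihalf {R : realType} (p : 'cV[R]_2) : dot p (u_ (pi / 2)) = p 1 0.
Proof. by rewrite dot_u cos_pihalf sin_pihalf mulr1 mulr0 add0r. Qed.

Lemma dot_v0 {R : realType} (p : 'cV[R]_2) : dot p (v_ 0) = p 1 0.
Proof. by rewrite dot_v cos0 sin0 mulr1 mulr0 subr0. Qed.

Lemma v_uE {R : realType} (t : R) : v_ t = u_ (t + pi / 2).
Proof. by apply/colP => i; rewrite !mxE cosDpihalf sinDpihalf. Qed.

Lemma colP2 {R : realType} (p q : 'cV[R]_2) :
  p 0 0 = q 0 0 -> p 1 0 = q 1 0 -> p = q.
Proof.
move=> e0 e1; apply/colP => -[[|[|//]] lt2];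
  by [rewrite (_ : Ordinal _ = 0) //; apply/val_inj
     |rewrite (_ : Ordinal _ = 1) //; apply/val_inj].
Qed.

Lemma mulmxE2 {R : realType} (A : 'M[R]_2) (p : 'cV[R]_2) i :
  (A *m p) i 0 = A i 0 * p 0 0 + A i 1 * p 1 0.
Proof.
rewrite mxE big_ord_recl big_ord1.
by rewrite (_ : lift ord0 ord0 = 1) //; apply/val_inj.
Qed.

Lemma rigid_act_x {R : realType} (g : 'M[R]_2 * 'cV[R]_2) p t :
  g.1 = rotmx (- t) -> rigid_act g p 0 0 = dot p (u_ t) + g.2 0 0.
Proof.
move=> e; rewrite /rigid_act mxE mulmxE2 e !mxE /= cosN sinN dot_u; ring.
Qed.

Lemma rigid_act_y {R : realType} (g : 'M[R]_2 * 'cV[R]_2) p t :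
  g.1 = rotmx (- t) -> rigid_act g p 1 0 = dot p (v_ t) + g.2 1 0.
Proof.
move=> e; rewrite /rigid_act mxE mulmxE2 e !mxE /= cosN sinN dot_v; ring.
Qed.

Lemma rotmx_SO2 {R : realType} (t : R) : SO2 R (rotmx t).
Proof.
have cs : cos t * cos t + sin t * sin t = 1 by rewrite -!expr2 cos2Dsin2.
split; last first.
  rewrite (expand_det_row _ 0) big_ord_recl big_ord1 /cofactor !det_mx11 !mxE.
  by rewrite /= /bump /= expr0 expr1; lra.
apply/matrixP => i j; rewrite mxE big_ord_recl big_ord1 !mxE /=.
case: i => [[|[|//]] ?]; case: j => [[|[|//]] ?] /=; lra.
Qed.

Lemma hallwayE {R : realType} (p : 'cV[R]_2) :
  hallway R p <-> [/\ p 0 0 <= 1, p 1 0 <= 1 & 0 <= p 0 0 \/ 0 <= p 1 0].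
Proof.
split=> [[[? /andP[? ?]]|[/andP[? ?] ?]]|[? ? [?|?]]].
- by split=> //; right.
- by split=> //; left.
- by right; split=> //; apply/andP.
- by left; split=> //; apply/andP.
Qed.

(** * Support functions *)

(** Matrices carry the product topology, so continuity is checked entrywise. *)
Lemma mx_continuous {R : realType} (T : topologicalType) m n
    (f : T -> 'M[R]_(m, n)) :
  (forall i j, continuous (fun x => f x i j)) ->
  continuous f.
Proof.
move=> fc x A [P Px PA].
have : \forall y \near x, forall i j, P i j (f y i j).
  apply: filter_forall => i; apply: filter_forall => j.
  exact: (fc i j x _ (Px i j)).
by apply: filterS => y Py; apply: PA.
Qed.

Lemma dot_continuous {R : realType} (u : 'cV[R]_2) :
  continuous (fun p : 'cV[R]_2 => dot p u).
Proof.
under eq_fun do rewrite dotE.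
move=> p; apply: (cvgD (F := nbhs p)); apply: (cvgM (F := nbhs p));
  by [exact: coord_continuous|exact: cvg_cst].
Qed.

(** Heine-Borel for column vectors, through transposition of a box of rows. *)
Lemma compact_coords {R : realType} (S : set 'cV[R]_2) (M : R) :
  closed S -> (forall q, S q -> forall i, `|q i 0| <= M) -> compact S.
Proof.
move=> Scl SM.
pose B := [set v : 'rV[R]_2 | forall i, `[- M, M]%classic (v ord0 i)].
have Bco : compact B.
  apply: (@rV_compact _ _ (fun=> `[- M, M]%classic)) => _.
  exact: segment_compact.
apply: (subclosed_compact (B := trmx @` B)) => // [|q Sq].
  apply: continuous_compact Bco; apply: continuous_subspaceT.
  apply: mx_continuous => i j.
  under eq_fun do rewrite mxE.
  exact: coord_continuous.
exists q^T; last by rewrite trmxK.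
by move=> i; rewrite mxE /= in_itv /= -ler_norml SM.
Qed.

Lemma hsupp_attained {R : realType} {S : set 'cV[R]_2} t :
  S !=set0 -> compact S -> exists2 q, S q & dot q (u_ t) = hsupp S t.
Proof.
move=> S0 Sco.
have [|q /set_mem Sq qmax] :=
    compact_EVT_max (f := fun p => dot p (u_ t)) S0 Sco.
  by apply: continuous_subspaceT => p; exact: dot_continuous.
have ubq : ubound [set dot s (u_ t) | s in S] (dot q (u_ t)).
  by move=> _ [r Sr <-]; apply: qmax; exact: mem_set.
exists q => //; apply/eqP; rewrite eq_le; apply/andP; split.
  by apply: ub_le_sup; [exists (dot q (u_ t))|exists q].
by apply: ge_sup => //; exists (dot q (u_ t)), q.
Qed.

Lemma hsupp_ub {R : realType} {S : set 'cV[R]_2} t {q} :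
  compact S -> S q -> dot q (u_ t) <= hsupp S t.
Proof.
move=> Sco Sq; apply: ub_le_sup; last by exists q.
have : compact [set dot s (u_ t) | s in S].
  apply: continuous_compact Sco; apply: continuous_subspaceT => p.
  exact: dot_continuous.
by move/compact_has_sup => -[|_ //]; exists (dot q (u_ t)), q.
Qed.

Lemma hsupp_le {R : realType} (S : set 'cV[R]_2) t c :
  S !=set0 -> (forall q, S q -> dot q (u_ t) <= c) -> hsupp S t <= c.
Proof.
move=> [q Sq] Sc; apply: ge_sup; first by exists (dot q (u_ t)), q.
by move=> _ [r Sr <-]; exact: Sc.
Qed.

Lemma hsupp_eq {R : realType} (S : set 'cV[R]_2) t c :
  (exists2 q, S q & dot q (u_ t) = c) ->
  (forall q, S q -> dot q (u_ t) <= c) -> hsupp S t = c.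
Proof.
move=> [q Sq qc] Sc; apply/eqP; rewrite eq_le; apply/andP; split.
  by apply: hsupp_le => //; exists q.
by apply: ub_le_sup; [exists c => _ [r Sr <-]; exact: Sc|exists q].
Qed.

(** With M + 1 a bound on the coordinates of S, the quantity
    (M + 1) (|cos x - cos t| + |sin x - sin t|) bounds the change of every
    s . u_t, hence the change of the supremum. *)
Lemma hsupp_continuous {R : realType} (S : set 'cV[R]_2) :
  S !=set0 -> compact S -> continuous (hsupp S).
Proof.
move=> S0 Sco.
have [M [_ SM]] := compact_bounded Sco.
have {}SM q i : S q -> `|q i 0| <= M + 1.
  move=> Sq; apply: le_trans (SM (M + 1) _ q Sq); last by rewrite ltrDl.
  rewrite [leRHS]/Num.norm /= mx_normrE.
  exact: (le_bigmax _ (fun ij : 'I_2 * 'I_1 => `|q ij.1 ij.2|) (i, 0)).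
pose g (t x : R) := (M + 1) * (`|cos x - cos t| + `|sin x - sin t|).
have gP (t x : R) q : S q -> dot q (u_ t) - dot q (u_ x) <= g t x.
  move=> Sq; rewrite !dot_u /g mulrDr.
  have -> : q 0 0 * cos t + q 1 0 * sin t - (q 0 0 * cos x + q 1 0 * sin x) =
      - (q 0 0 * (cos x - cos t) + q 1 0 * (sin x - sin t)) by ring.
  apply: le_trans (ler_norm _) _; rewrite normrN.
  apply: le_trans (ler_normD _ _) _; rewrite !normrM.
  by apply: lerD; apply: ler_wpM2r; rewrite ?SM.
have lip (t x : R) : hsupp S t - hsupp S x <= g t x.
  have [q Sq <-] := hsupp_attained t S0 Sco.
  by apply: le_trans (gP t x q Sq); rewrite lerB // hsupp_ub.
move=> t.
have gt0 : g t x @[x --> t] --> (0 : R).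
  have -> : (0 : R) = g t t by rewrite /g !subrr !normr0 addr0 mulr0.
  apply: cvgMr; apply: cvgD; apply: cvg_norm; apply: cvgB;
    by [exact: continuous_cos|exact: continuous_sin|exact: cvg_cst].
apply: (squeeze_cvgr (f := fun x => hsupp S t - g t x)
                     (h := fun x => hsupp S t + g t x)).
- near=> x.
  have gC : g x t = g t x by rewrite /g (distrC (cos t)) (distrC (sin t)).
  by have := lip t x; have := lip x t; rewrite gC; lra.
- by rewrite -[X in _ --> X]subr0; apply: cvgB => //; exact: cvg_cst.
- by rewrite -[X in _ --> X]addr0; apply: cvgD => //; exact: cvg_cst.
Unshelve. all: by end_near.
Qed.

(** * Supporting hallways *)

(** The rigid motion carrying the supporting hallway at angle t onto the
    hallway. *)
Definition supp_frame {R : realType} (S : set 'cV[R]_2) (t : R) :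
    'M[R]_2 * 'cV[R]_2 :=
  (rotmx (- t), \col_i (1 - hsupp S (if i == 0 then t else t + pi / 2))).

Lemma supp_frame_x {R : realType} (S : set 'cV[R]_2) t p :
  rigid_act (supp_frame S t) p 0 0 = dot p (u_ t) + (1 - hsupp S t).
Proof. by rewrite (@rigid_act_x _ _ _ t) // mxE. Qed.

Lemma supp_frame_y {R : realType} (S : set 'cV[R]_2) t p :
  rigid_act (supp_frame S t) p 1 0 = dot p (v_ t) + (1 - hsupp S (t + pi / 2)).
Proof. by rewrite (@rigid_act_y _ _ _ t) // mxE. Qed.

Lemma supp_hallway_frame {R : realType} (S : set 'cV[R]_2) t p :
  supp_hallway S t p <-> hallway R (rigid_act (supp_frame S t) p).
Proof.
have ss : sin t ^+ 2 = 1 - cos t ^+ 2 by rewrite -(cos2Dsin2 t) addrC addKr.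
have E (x : 'cV[R]_2) a b i : (rotmx t *m x + a *: u_ t + b *: v_ t) i 0 =
    rotmx t i 0 * x 0 0 + rotmx t i 1 * x 1 0 + a * u_ t i 0 + b * v_ t i 0.
  rewrite mxE; congr (_ + _); last by rewrite mxE.
  by rewrite mxE mulmxE2; congr (_ + _); rewrite mxE.
split=> [[x Lx <-]|Lp]; last first.
  exists (rigid_act (supp_frame S t) p) => //.
  by apply: colP2; rewrite E supp_frame_x supp_frame_y dot_u dot_v !mxE /=;
    ring: ss.
rewrite (_ : rigid_act _ _ = x) //; apply: colP2.
  by rewrite supp_frame_x dot_u !E !mxE /=; ring: ss.
by rewrite supp_frame_y dot_v !E !mxE /=; ring: ss.
Qed.

(** An outer corner, given by the two inequalities, from which the inner
    quadrant is removed, given by the alternative. *)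
Lemma supp_hallwayE {R : realType} (S : set 'cV[R]_2) t p :
  supp_hallway S t p <->
  [/\ dot p (u_ t) <= hsupp S t, dot p (v_ t) <= hsupp S (t + pi / 2) &
      hsupp S t - 1 <= dot p (u_ t) \/
      hsupp S (t + pi / 2) - 1 <= dot p (v_ t)].
Proof.
rewrite supp_hallway_frame hallwayE supp_frame_x supp_frame_y.
by split=> -[? ? [?|?]]; split; by [lra|left; lra|right; lra].
Qed.

(** Measured along u_t and v_t, the outer walls of the hallway transported by
    the inverse of g are at 1 - g.2, so the supporting lines of S are at most
    that far. Pulling the walls back to these lines moves the inner quadrant
    back by the same amounts, so S still avoids it. *)
Lemma hallway_subset_supp {R : realType} (S : set 'cV[R]_2) g t :
  compact S -> g.1 = rotmx (- t) -> rigid_act g @` S `<=` hallway R ->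
  S `<=` supp_hallway S t.
Proof.
move=> Sco gt gL q Sq; have S0 : S !=set0 by exists q.
have L r : S r -> _ := fun Sr =>
  (hallwayE (rigid_act g r)).1 (gL _ (ex_intro2 _ _ r Sr erefl)).
have hx : hsupp S t <= 1 - g.2 0 0.
  apply: hsupp_le => // r /L[+ _ _]; rewrite (rigid_act_x _ _ t gt); lra.
have hy : hsupp S (t + pi / 2) <= 1 - g.2 1 0.
  by apply: hsupp_le => // r /L[_ + _];
    rewrite (rigid_act_y _ _ t gt) v_uE; lra.
apply/supp_hallwayE; rewrite v_uE !hsupp_ub //; split=> //.
have [_ _] := L q Sq.
rewrite (rigid_act_x _ _ t gt) (rigid_act_y _ _ t gt) v_uE.
by case=> ?; [left|right]; lra.
Qed.

(** * What a movement says about the sofa *)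

(** The intermediate value theorem, applied to the lift of the angle. *)
Lemma movement_turns {R : realType} {S : set 'cV[R]_2} {Phi w} t :
  movement S Phi -> rotation_angle Phi w -> 0 <= t <= w ->
  exists2 g, g.1 = rotmx (- t) & rigid_act g @` S `<=` hallway R.
Proof.
move=> [_ _ _ _ PhiL] [theta [thc th0 thr th1]] /andP[t0 tw].
have [|s] := IVT (v := t) ler01 thc.
  by rewrite th0 th1 min_l ?max_r ?t0 ?tw // (le_trans t0 tw).
rewrite in_itv /= => s01 ths.
by exists (Phi s); [rewrite thr ?ths|exact: PhiL].
Qed.

Lemma movement_start {R : realType} {S : set 'cV[R]_2} {Phi w} :
  movement S Phi -> rotation_angle Phi w ->
  exists2 g, g.1 = rotmx (- 0) & rigid_act g @` S `<=` hall_H R.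
Proof.
move=> [_ _ _ [PhiH _] _] [theta [_ th0 thr _]].
by exists (Phi 0) => //; rewrite thr ?th0 // lexx ler01.
Qed.

Lemma movement_end {R : realType} {S : set 'cV[R]_2} {Phi w} :
  movement S Phi -> rotation_angle Phi w ->
  exists2 g, g.1 = rotmx (- w) & rigid_act g @` S `<=` hall_V R.
Proof.
move=> [_ _ _ [_ PhiV] _] [theta [_ _ thr th1]].
by exists (Phi 1) => //; rewrite thr ?th1 // lexx ler01.
Qed.

Lemma sin_gt0_quarter {R : realType} {w : R} : 0 < w <= pi / 2 -> 0 < sin w.
Proof.
move=> /andP[w0 wpi]; apply: sin_gt0_pi; rewrite w0 /=.
by have := pi_gt0 R; lra.
Qed.

(** The initial position bounds y on both sides and x above. The final one
    bounds q . v_w = y cos w - x sin w above; as sin w > 0, x is bounded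
    below. Using v_w instead of the strip along u_w also covers w = pi/2, where
    the two strips are parallel. *)
Lemma sofa_compact {R : realType} {S : set 'cV[R]_2} {Phi w} :
  0 < w <= pi / 2 -> closed S -> movement S Phi -> rotation_angle Phi w ->
  compact S.
Proof.
move=> wP Scl mv ra.
have [g gr gH] := movement_start mv ra.
have [h hr hV] := movement_end mv ra.
have sw := sin_gt0_quarter wP.
pose Y := 1 + `|g.2 1 0|.
pose X := `|1 - g.2 0 0| + (Y + `|1 - h.2 1 0|) / sin w.
apply: (compact_coords S (X + Y)) => // q Sq.
have [+ /andP[+ +]] := gH _ (ex_intro2 _ _ q Sq erefl).
rewrite (rigid_act_x _ _ 0 gr) (rigid_act_y _ _ 0 gr) dot_u0 dot_v0 => x1 y0 y1.
have [_] := hV _ (ex_intro2 _ _ q Sq erefl).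
rewrite (rigid_act_y _ _ w hr) dot_v => v1.
have Y0 : 0 <= Y by rewrite addr_ge0.
have X0 : 0 <= X by rewrite addr_ge0 // divr_ge0 ?addr_ge0 // ltW.
have yY : `|q 1 0| <= Y.
  have := ler_norm (g.2 1 0); have := ler_norm (- g.2 1 0); rewrite normrN.
  by rewrite ler_norml /Y => ? ?; apply/andP; split; lra.
have xX : `|q 0 0| <= X.
  rewrite ler_norml; apply/andP; split; last first.
    apply: (@le_trans _ _ `|1 - g.2 0 0|); last first.
      by rewrite lerDl divr_ge0 ?addr_ge0 // ltW.
    by apply: le_trans (ler_norm _); lra.
  rewrite lerNl -(ler_pM2r sw) mulrDl divfK ?gt_eqF //.
  have : 0 <= `|1 - g.2 0 0| * sin w by rewrite mulr_ge0 // ltW.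
  have : - (q 1 0 * cos w) <= Y.
    apply: le_trans (ler_norm _) _; rewrite normrN normrM.
    by rewrite -[Y]mulr1; apply: ler_pM => //; exact: cos_max.
  by have := ler_norm (1 - h.2 1 0); lra.
move=> i; have [->|->] : i = 0 \/ i = 1.
- by case: i => [[|[|//]] ?]; [left|right]; apply/val_inj.
- by rewrite (le_trans xX) // lerDl.
- by rewrite (le_trans yY) // lerDr.
Qed.

(** The unit strip that contains S must have its upper edge at height at least
    1, where S has a point, so its lower edge is at height at least 0. *)
Lemma unit_strip {R : realType} {S : set 'cV[R]_2} {t c} :
  S !=set0 -> compact S -> hsupp S t = 1 ->
  (forall q, S q -> 0 <= dot q (u_ t) + c <= 1) ->
  forall q, S q -> 0 <= dot q (u_ t) <= 1.
Proof.
move=> S0 Sco h1 Sc q Sq.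
have [r /Sc/andP[_ r1] rt] := hsupp_attained t S0 Sco.
have := hsupp_ub t Sco Sq; have /andP[q0 _] := Sc q Sq.
by move: rt r1; rewrite h1 => -> ? ->; rewrite andbT; lra.
Qed.

Lemma sofa_subset_calI {R : realType} {S : set 'cV[R]_2} {Phi w} :
  S !=set0 -> compact S -> movement S Phi -> rotation_angle Phi w ->
  standard_position w S -> S `<=` calI w S.
Proof.
move=> S0 Sco mv ra [hw hpi] q Sq; split; [split|].
- have [g gr gH] := movement_start mv ra.
  apply: (unit_strip (c := g.2 1 0) S0 Sco hpi) Sq => r Sr.
  rewrite dot_u_pihalf; have [_] := gH _ (ex_intro2 _ _ r Sr erefl).
  by rewrite (rigid_act_y _ _ 0 gr) dot_v0.
- have [g gr gV] := movement_end mv ra.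
  apply: (unit_strip (c := g.2 0 0) S0 Sco hw) Sq => r Sr.
  have [+ _] := gV _ (ex_intro2 _ _ r Sr erefl).
  by rewrite (rigid_act_x _ _ w gr).
- move=> t; rewrite /= in_itv /= => tw.
  have [g gr gL] := movement_turns t mv ra tw.
  exact: hallway_subset_supp gr gL q Sq.
Qed.

(** * Connectedness of the intersection *)

Definition segment {R : realType} (p q : 'cV[R]_2) : set 'cV[R]_2 :=
  [set p + a *: (q - p) | a in `[0, 1]].

Lemma segment_sym {R : realType} (p q : 'cV[R]_2) :
  segment p q `<=` segment q p.
Proof.
move=> _ [a /= + <-]; rewrite in_itv /= => /andP[a0 a1].
exists (1 - a); first by rewrite /= in_itv /=; apply/andP; split; lra.
by apply/colP => i; rewrite !mxE; ring.
Qed.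

Lemma connected_segment {R : realType} (p q : 'cV[R]_2) :
  connected (segment p q).
Proof.
apply: connected_continuous_connected; first exact: segment_connected.
apply: continuous_subspaceT; apply: mx_continuous => i j.
under eq_fun do rewrite !mxE.
move=> x; apply: (cvgD (F := nbhs x)); first exact: cvg_cst.
by apply: (cvgM (F := nbhs x)); [exact: cvg_id|exact: cvg_cst].
Qed.

(** The segments need not have a common point, but the union of each of them
    with S is connected and contains S. *)
Lemma connected_star {R : realType} (S I : set 'cV[R]_2) :
  S !=set0 -> connected S -> S `<=` I ->
  (forall p, I p -> exists2 q, S q & segment p q `<=` I) -> connected I.
Proof.
move=> [s Ss] Sc SI reach.
pose P := [set pq : 'cV[R]_2 * 'cV[R]_2 | S pq.2 /\ segment pq.1 pq.2 `<=` I].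
have -> : I = \bigcup_(pq in P) (S `|` segment pq.1 pq.2).
  apply/seteqP; split=> [p Ip|p [pq [_ sI] [/SI //|/sI //]]].
  have [q Sq sI] := reach p Ip; exists (p, q) => //; right.
  by exists 0; rewrite ?scale0r ?addr0 //= in_itv /= lexx ler01.
apply: bigcup_connected => [|pq [Sq _]]; first by exists s => pq _; left.
apply: connectedU => //; last exact: connected_segment.
exists pq.2; split=> //; exists 1; last by rewrite scale1r addrC subrK.
by rewrite /= in_itv /= lexx ler01.
Qed.

(** The values of a linear form on S make an interval which contains its
    supremum: a level c below the supremum is met unless the whole interval is
    above it. Compactness matters when c is the supremum itself. *)
Lemma connected_crosses {R : realType} (S : set 'cV[R]_2) t c :
  S !=set0 -> compact S -> connected S -> c <= hsupp S t ->
  (exists2 q, S q & dot q (u_ t) = c) \/ (forall q, S q -> c < dot q (u_ t)).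
Proof.
move=> S0 Sco Sc cS; have [q Sq qh] := hsupp_attained t S0 Sco.
have [|meets] := pselect (exists2 q, S q & dot q (u_ t) = c); first by left.
right=> r Sr; rewrite ltNge; apply/negP => rc; apply: meets.
have : connected [set dot s (u_ t) | s in S].
  apply: connected_continuous_connected => //.
  by apply: continuous_subspaceT => p; exact: dot_continuous.
move/connected_intervalP => /(_ (dot r (u_ t)) (dot q (u_ t))).
have Ir : [set dot s (u_ t) | s in S] (dot r (u_ t)) by exists r.
have Iq : [set dot s (u_ t) | s in S] (dot q (u_ t)) by exists q.
by move=> /(_ Ir Iq c) []; [rewrite rc qh|move=> x; exists x].
Qed.

(** Translation by such a d, for every t in [0, w] at once, keeps a point out of
    the inner quadrant at t whenever it was out of it. *)
Definition up_dir {R : realType} (w : R) (d : 'cV[R]_2) : Prop :=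
  forall t, 0 <= t <= w -> 0 <= dot d (u_ t) /\ 0 <= dot d (v_ t).

(** The angles of u_w and u_(pi/2) both lie in every range [t, t + pi/2] with
    t in [0, w], and these two directions are the ends of the intersection of
    the ranges. *)
Lemma up_dirP {R : realType} (w a b : R) :
  w <= pi / 2 -> 0 <= a -> 0 <= b -> up_dir w (a *: u_ w + b *: u_ (pi / 2)).
Proof.
move=> wpi a0 b0 t /andP[t0 tw]; have pi0 := pi_gt0 R.
rewrite dot_u dot_v !mxE /= cos_pihalf sin_pihalf.
have -> : (a * cos w + b * 0) * cos t + (a * sin w + b * 1) * sin t =
    a * cos (w - t) + b * sin t by rewrite cosB; ring.
have -> : (a * sin w + b * 1) * cos t - (a * cos w + b * 0) * sin t =
    a * sin (w - t) + b * cos t by rewrite sinB; ring.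
split; apply: addr_ge0; apply: mulr_ge0 => //.
- by apply: cos_ge0_pihalf; apply/andP; split; lra.
- by apply: sin_ge0_pi; apply/andP; split; lra.
- by apply: sin_ge0_pi; apply/andP; split; lra.
- by apply: cos_ge0_pihalf; apply/andP; split; lra.
Qed.

Lemma dot_segment {R : realType} (p q r : 'cV[R]_2) a :
  dot (p + a *: (q - p)) r = dot p r + a * dot (q - p) r.
Proof. by rewrite !dotE !mxE; ring. Qed.

Lemma dotB {R : realType} (p q r : 'cV[R]_2) :
  dot (q - p) r = dot q r - dot p r.
Proof. by rewrite !dotE !mxE; ring. Qed.

(** The strips and the outer walls are convex conditions, inherited from the
    two ends; the inner quadrant is avoided already at p, and moving up towards
    q cannot enter it. *)
Lemma segment_up {R : realType} {S : set 'cV[R]_2} {w p q} :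
  calI w S p -> calI w S q -> up_dir w (q - p) -> segment p q `<=` calI w S.
Proof.
move=> [[pP1 pP2] pL] [[qP1 qP2] qL] up _ [a /= + <-].
rewrite in_itv /= => /andP[a0 a1].
have strip (l h : R) r : l <= dot p r <= h -> l <= dot q r <= h ->
    l <= dot (p + a *: (q - p)) r <= h.
  rewrite dot_segment dotB => /andP[? ?] /andP[? ?]; apply/andP; split; nra.
split=> [|t tw]; first by split; apply: strip.
have [pu pv pn] := (supp_hallwayE _ _ _).1 (pL t tw).
have [qu qv _] := (supp_hallwayE _ _ _).1 (qL t tw).
have [du dv] : 0 <= dot (q - p) (u_ t) /\ 0 <= dot (q - p) (v_ t).
  by apply: up; move: tw; rewrite /= in_itv.
have adu := mulr_ge0 a0 du; have adv := mulr_ge0 a0 dv.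
apply/supp_hallwayE; rewrite !dot_segment; split.
- by move: du; rewrite dotB; nra.
- by move: dv; rewrite dotB; nra.
- by case: pn => ?; [left|right]; lra.
Qed.

(** The vertical line through p and the line through p along u_w have normals
    u_0 and v_w = u_(w + pi/2), at which I lies below the supporting lines of S.
    If S meets neither, it is strictly on the positive side of both normals, and
    this open wedge at p is the interior of the cone of u_w and u_(pi/2); for
    w = pi/2 the wedge is empty, as then v_w = - u_0. *)
Lemma calI_reaches {R : realType} {S : set 'cV[R]_2} {w p} :
  0 < w <= pi / 2 -> S !=set0 -> compact S -> connected S -> calI w S p ->
  exists2 q, S q & up_dir w (q - p) \/ up_dir w (p - q).
Proof.
move=> /andP[w0 wpi] S0 Sco Sc [_ pL].
have updown (d : 'cV[R]_2) a b : d = a *: u_ w + b *: u_ (pi / 2) ->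
    (0 <= a /\ 0 <= b) \/ (a <= 0 /\ b <= 0) -> up_dir w d \/ up_dir w (- d).
  move=> -> [] [a0 b0]; [left|right]; first exact: up_dirP.
  by rewrite opprD -!scaleNr; apply: up_dirP; rewrite ?oppr_ge0.
have reach q a b : S q -> q - p = a *: u_ w + b *: u_ (pi / 2) ->
    (0 <= a /\ 0 <= b) \/ (a <= 0 /\ b <= 0) ->
    exists2 q, S q & up_dir w (q - p) \/ up_dir w (p - q).
  by move=> Sq e s; exists q => //; rewrite -(opprB q p); exact: updown e s.
have ss : sin w ^+ 2 = 1 - cos w ^+ 2 by rewrite -(cos2Dsin2 w) addrC addKr.
have cw0 : 0 <= cos w by apply: cos_ge0_pihalf; apply/andP; split; lra.
have sw0 : 0 < sin w by apply: sin_gt0_quarter; rewrite w0.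
have [|[q Sq q0]|right0] := connected_crosses S 0 (dot p (u_ 0)) S0 Sco Sc.
- have [] // := (supp_hallwayE S 0 p).1 _.
  by apply: pL; rewrite /= in_itv /= lexx ltW.
(* S meets the vertical line through p. *)
- move: q0; rewrite !dot_u0 => q0.
  apply: (reach q 0 (q 1 0 - p 1 0)) => //.
    by apply: colP2; rewrite !mxE /= ?cos_pihalf ?sin_pihalf ?q0; ring.
  by have [?|/ltW ?] := leP (p 1 0) (q 1 0); [left|right]; split; lra.
have [|[q Sq qw]|rightw] :=
  connected_crosses S (w + pi / 2) (dot p (u_ (w + pi / 2))) S0 Sco Sc.
- have [] // := (supp_hallwayE S w p).1 _; last by rewrite v_uE.
  by apply: pL; rewrite /= in_itv /= lexx ltW.
(* S meets the line through p in direction u_w. *)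
- move: qw; rewrite -!v_uE => /eqP; rewrite -subr_eq0 -dotB dot_v => /eqP qw.
  apply: (reach q (dot (q - p) (u_ w)) 0) => //.
    have qw' : (q - p) 1 0 * cos w = (q - p) 0 0 * sin w by lra.
    rewrite dot_u scale0r addr0; apply: colP2;
      rewrite [RHS]mxE [X in _ = _ * X]mxE /=.
      have -> : ((q - p) 0 0 * cos w + (q - p) 1 0 * sin w) * cos w =
        (q - p) 0 0 * cos w ^+ 2 + ((q - p) 1 0 * cos w) * sin w by ring.
      by rewrite qw'; ring: ss.
    have -> : ((q - p) 0 0 * cos w + (q - p) 1 0 * sin w) * sin w =
      (q - p) 1 0 * sin w ^+ 2 + ((q - p) 0 0 * sin w) * cos w by ring.
    by rewrite -qw'; ring: ss.
  by have [?|/ltW ?] := leP 0 (dot (q - p) (u_ w)); [left|right].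
(* S lies in the wedge: solve q - p = a u_w + b u_(pi/2) by pairing with u_0
   and v_w, both of which give the factor cos w. *)
have [q Sq] := S0.
have := right0 q Sq; rewrite -subr_gt0 -dotB dot_u0 => dx.
have := rightw q Sq; rewrite -v_uE -subr_gt0 -dotB => dv.
have cw : 0 < cos w.
  rewrite lt_def cw0 andbT; apply/eqP => cw; move: dv.
  by rewrite dot_v cw mulr0 sub0r oppr_gt0 ltNge mulr_ge0 // ltW.
apply: (reach q ((q - p) 0 0 / cos w) (dot (q - p) (v_ w) / cos w)) => //.
  rewrite dot_v; apply: colP2; rewrite [RHS]mxE [X in _ = X + _]mxE
    [X in _ = _ + X]mxE [X in _ = _ * X + _]mxE [X in _ = _ + _ * X]mxE /=.
    by rewrite cos_pihalf; field; rewrite gt_eqF.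
  by rewrite sin_pihalf; field; rewrite gt_eqF.
by left; split; apply: divr_ge0; exact: ltW.
Qed.

Lemma calI_connected {R : realType} {S : set 'cV[R]_2} {w} :
  0 < w <= pi / 2 -> S !=set0 -> compact S -> connected S ->
  S `<=` calI w S -> connected (calI w S).
Proof.
move=> wP S0 Sco Sc SI; apply: (connected_star S) => // p Ip.
have [q Sq [up|down]] := calI_reaches wP S0 Sco Sc Ip; exists q => //.
  exact: segment_up Ip (SI q Sq) up.
by apply: subset_trans (segment_sym p q) _; exact: segment_up (SI q Sq) Ip down.
Qed.

Lemma calI_closed {R : realType} (S : set 'cV[R]_2) w : closed (calI w S).
Proof.
have le_cl (u : 'cV[R]_2) c : closed [set p | dot p u <= c].
  apply: (@preimage_closed _ _ (fun p => dot p u) [set x | x <= c]) => [p _|].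
    exact: dot_continuous.
  exact: closed_le.
have ge_cl (u : 'cV[R]_2) c : closed [set p | c <= dot p u].
  apply: (@preimage_closed _ _ (fun p => dot p u) [set x | c <= x]) => [p _|].
    exact: dot_continuous.
  exact: closed_ge.
have strip_cl (u : 'cV[R]_2) : closed [set p | 0 <= dot p u <= 1].
  rewrite (_ : mkset _ = [set p | 0 <= dot p u] `&` [set p | dot p u <= 1]).
    exact: closedI.
  by apply/seteqP; split=> p /andP.
apply: closedI.
  exact: (closedI (strip_cl (u_ (pi / 2))) (strip_cl (u_ w))).
apply: closed_bigI => t _.
rewrite (_ : supp_hallway S t =
  [set p | dot p (u_ t) <= hsupp S t] `&`
  [set p | dot p (v_ t) <= hsupp S (t + pi / 2)] `&`
  ([set p | hsupp S t - 1 <= dot p (u_ t)] `|`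
   [set p | hsupp S (t + pi / 2) - 1 <= dot p (v_ t)])).
  by apply: closedI; [exact: closedI|exact: closedU].
apply/seteqP; split=> p.
  by move=> /supp_hallwayE[? ? ?]; split.
by move=> [[? ?] ?]; apply/supp_hallwayE; split.
Qed.

(** * The movement of the intersection *)

Lemma calI_standard {R : realType} (S : set 'cV[R]_2) w :
  S !=set0 -> compact S -> standard_position w S -> S `<=` calI w S ->
  standard_position w (calI w S).
Proof.
move=> S0 Sco [hw hpi] SI; split; apply: hsupp_eq.
- by have [q Sq qw] := hsupp_attained w S0 Sco; exists q; rewrite ?qw; auto.
- by move=> q [[_ /andP[]]].
- have [q Sq qw] := hsupp_attained (pi / 2) S0 Sco.
  by exists q; rewrite ?qw; auto.
- by move=> q [[/andP[]]].
Qed.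

(** At time s, the supporting hallway at angle s w is carried onto the hallway;
    the angle runs at constant speed and is its own continuous lift. *)
Lemma calI_moves {R : realType} (S : set 'cV[R]_2) w :
  0 < w -> S !=set0 -> compact S -> standard_position w S ->
  exists Phi, movement (calI w S) Phi /\ rotation_angle Phi w.
Proof.
move=> w0 S0 Sco [hw hpi].
have scale_cont : continuous (fun s : R => s * w).
  by move=> s; apply: (cvgM (F := nbhs s)); [exact: cvg_id|exact: cvg_cst].
have comp_cont (f : R -> R) :
    continuous f -> continuous (fun s : R => f (s * w)).
  by move=> fc s; apply: continuous_comp; [exact: scale_cont|exact: fc].
have rot_cont : continuous (fun s : R => rotmx (- (s * w))).
  apply: mx_continuous => i j; under eq_fun do rewrite !mxE cosN sinN.
  apply: (comp_cont (fun t => if j == 0 then if i == 0 then cos t else - sin t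
    else if i == 0 then - - sin t else cos t)).
  case: (j == 0); case: (i == 0) => t.
  - exact: continuous_cos.
  - by apply: (cvgN (F := nbhs t)); exact: continuous_sin.
  - by under eq_fun do rewrite opprK; exact: continuous_sin.
  - exact: continuous_cos.
have shift_cont : continuous (fun s : R => (supp_frame S (s * w)).2).
  apply: mx_continuous => i j; under eq_fun do rewrite !mxE.
  apply: (comp_cont (fun t => 1 - hsupp S (if i == 0 then t else t + pi / 2))).
  move=> t; apply: (cvgB (F := nbhs t)); first exact: cvg_cst.
  case: (i == 0); first exact: hsupp_continuous.
  apply: (continuous_comp (f := fun t => t + pi / 2)).
    by apply: (cvgD (F := nbhs t)); [exact: cvg_id|exact: cvg_cst].
  exact: hsupp_continuous.
have frame_cont : continuous (fun s : R => supp_frame S (s * w)).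
  by move=> s; exact: (cvg_pair (F := nbhs s) (rot_cont s) (shift_cont s)).
have sw s : 0 <= s <= 1 -> 0 <= s * w <= w.
  move=> /andP[s0 s1]; apply/andP; split.
    by apply: mulr_ge0 => //; exact: ltW.
  by rewrite ler_piMl // ltW.
have inL s q : 0 <= s <= 1 -> calI w S q ->
    hallway R (rigid_act (supp_frame S (s * w)) q).
  by move=> s01 [_ qL]; apply/supp_hallway_frame/qL; rewrite /= in_itv /= sw.
exists (fun s => supp_frame S (s * w)); split; [split|].
- exact: continuous_subspaceT.
- by move=> s _; exact: rotmx_SO2.
- rewrite mul0r /= oppr0; apply/matrixP => -[[|[|//]] ?] [[|[|//]] ?];
    by rewrite !mxE /= ?cos0 ?sin0 ?oppr0.
- split=> _ [q [[qy qw] qL] <-].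
    have [] := (hallwayE _).1 (inL 0 q _ _); rewrite ?lexx ?ler01 //.
    rewrite mul0r /hall_H /= !supp_frame_y add0r hpi subrr addr0 dot_v0.
    rewrite -dot_u_pihalf.
    by move=> ? _ _; split.
  have [] := (hallwayE _).1 (inL 1 q _ _); rewrite ?lexx ?ler01 //.
  rewrite mul1r /hall_V /= !supp_frame_x hw subrr addr0.
  by move=> _ ? _; split.
- by move=> s s01 _ [q Iq <-]; exact: inL.
exists (fun s => s * w); split; rewrite ?mul0r ?mul1r //.
exact: continuous_subspaceT.
Qed.

Theorem theorem2p3p2 (R : realType) (w : R) (S : set 'cV[R]_2) :
  0 < w <= pi / 2 ->
  moving_sofa w S ->
  standard_position w S ->
  [/\ moving_sofa w (calI w S),
      standard_position w (calI w S) &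
      S `<=` calI w S].
Proof.
move=> wP [S0 Sc Scl [Phi [mv ra]]] std.
have Sco := sofa_compact wP Scl mv ra.
have SI := sofa_subset_calI S0 Sco mv ra std.
split=> //; last exact: calI_standard.
split.
- by have [q Sq] := S0; exists q; exact: SI.
- exact: calI_connected.
- exact: calI_closed.
- by apply: calI_moves => //; have /andP[] := wP.
Qed.
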